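(* Let $R=\{(0,0),(0,1),(1,0),(1,1)\}\subseteq\{0,1,2\}^2$. Then the mesh patterns $(12,R)$ and $(21,R)$ are equidistributed: $(12,R)\sim_d(21,R)$.
   Context: $S_n$ denotes the set of permutations of $[n]=\{1,\dots,n\}$, written $\pi=\pi_1\cdots\pi_n$. A mesh pattern of length $k$ is a pair $(\tau,R)$ with $\tau\in S_k$ and $R\subseteq\{0,1,\dots,k\}^2$ (the shaded boxes; box $(a,b)$ is the unit square $[a,a+1]\times[b,b+1]$ in the diagram of $\tau$). An occurrence of $(\tau,R)$ in $\pi\in S_n$ is a choice of indices $i_1<\dots<i_k$ such that $\pi_{i_1}\cdots\pi_{i_k}$ is order-isomorphic to $\tau$ and, with $i_0=0$, $i_{k+1}=n+1$, $v_1<\dots<v_k$ the values $\pi_{i_1},\dots,\pi_{i_k}$ sorted increasingly, $v_0=0$, $v_{k+1}=n+1$, for every $(a,b)\in R$ there is no index $m$ with $i_a<m<i_{a+1}$ and $v_b<\pi_m<v_{b+1}$. Mesh patterns $p,q$ are equidistributed, $p\sim_d q$, if for all $n,\ell\ge0$ the number of $\pi\in S_n$ with exactly $\ell$ occurrences of $p$ equals the number with exactly $\ell$ occurrences of $q$. *)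

(* Defs.v *)
From mathcomp Require Import all_boot all_fingroup.

Set Implicit Arguments.
Unset Strict Implicit.
Unset Printing Implicit Defensive.

(** A permutation of [n] = {1, ..., n} is [pi : 'S_n], which acts on
    {0, ..., n-1}: the one-line entry pi_(i+1) is [(pi i).+1].  Below, positions
    and values are shifted back to {1, ..., n} whenever they are compared with
    the sentinels 0 and n+1. *)

Record mesh_pattern := MeshPattern {
  mesh_length : nat;
  mesh_perm : 'S_mesh_length;
  mesh_shading : {set 'I_mesh_length.+1 * 'I_mesh_length.+1}
}.

Section Occurrences.

Variables (n : nat) (pi : 'S_n).

(** A choice of indices is a function [f : {ffun 'I_k -> 'I_n}], with
    i_(j+1) = [(f j).+1]. *)

Definition increasing k (f : {ffun 'I_k -> 'I_n}) : bool :=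
  [forall a : 'I_k, forall b : 'I_k, (a < b) ==> (f a < f b)].

Definition order_isomorphic k (f : {ffun 'I_k -> 'I_n}) (tau : 'S_k) : bool :=
  [forall a : 'I_k, forall b : 'I_k, (pi (f a) < pi (f b)) == (tau a < tau b)].

(** i_a for 0 <= a <= k+1; the default of [nth] provides i_(k+1) = n+1. *)
Definition occ_index k (f : {ffun 'I_k -> 'I_n}) (a : nat) : nat :=
  nth n.+1 (0 :: [seq (f j).+1 | j <- enum 'I_k]) a.

(** v_b for 0 <= b <= k+1; the default of [nth] provides v_(k+1) = n+1. *)
Definition occ_value k (f : {ffun 'I_k -> 'I_n}) (b : nat) : nat :=
  nth n.+1 (0 :: sort leq [seq (pi (f j)).+1 | j <- enum 'I_k]) b.

Definition box_empty k (f : {ffun 'I_k -> 'I_n}) (a b : nat) : bool :=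
  ~~ [exists m : 'I_n,
        (occ_index f a < m.+1 < occ_index f a.+1) &&
        (occ_value f b < (pi m).+1 < occ_value f b.+1)].

Definition is_occurrence (p : mesh_pattern)
    (f : {ffun 'I_(mesh_length p) -> 'I_n}) : bool :=
  [&& increasing f,
      order_isomorphic f (mesh_perm p)
    & [forall c in mesh_shading p, box_empty f c.1 c.2]].

Definition num_occurrences (p : mesh_pattern) : nat :=
  #|[set f | is_occurrence (p := p) f]|.

End Occurrences.

Definition equidistributed (p q : mesh_pattern) : Prop :=
  forall n l : nat,
    #|[set pi : 'S_n | num_occurrences pi p == l]| =
    #|[set pi : 'S_n | num_occurrences pi q == l]|.

Definition perm12 : 'S_2 := 1%g.
Definition perm21 : 'S_2 := tperm ord0 ord_max.

Definition shading_R : {set 'I_3 * 'I_3} :=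
  [set (inord 0, inord 0); (inord 0, inord 1);
       (inord 1, inord 0); (inord 1, inord 1)].

(* Main.v *)
Require Import Defs.
From mathcomp Require Import all_boot all_fingroup.
From mathcomp Require Import zify.

Set Implicit Arguments.
Unset Strict Implicit.
Unset Printing Implicit Defensive.

(** Let [c_j] be the number of smaller entries to the left of [pi_j].  An
    occurrence of [(12, R)] is determined by its right point [j], and [j] is such
    a point iff [c_j = 1].  An occurrence of [(21, R)] consists of a
    left-to-right minimum [j] that is not in first position, together with the
    previous left-to-right minimum, so it corresponds to a position [j > 0] with
    [c_j = 0].  The code [c] is a bijection from permutations onto the sequences
    with [c_j <= j] (positions counted from 0), and exchanging the values 0 and 1
    in all positions [j > 0] is an involution of these sequences. *)

(** * Permutation codes and the exchange of the values 0 and 1 *)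

Section Code.

Variable n : nat.
Implicit Types (pi rho : 'S_n) (i j m : 'I_n).

Definition smaller_before pi j : {set 'I_n} :=
  [set i : 'I_n | (i < j) && (pi i < pi j)].

(** The codomain ['I_n.+2] makes both 0 and 1 available for every [n]. *)
Definition code pi : {ffun 'I_n -> 'I_n.+2} :=
  [ffun j => inord #|smaller_before pi j|].

Definition subexcedant (j : 'I_n) : pred 'I_n.+2 := [pred k : 'I_n.+2 | k <= j].

Lemma card_smaller_before pi j : #|smaller_before pi j| <= j.
Proof.
rewrite -[X in _ <= X]card_ord.
have ltjn := ltnW (ltn_ord j).
rewrite -(card_image (f := widen_ord ltjn)); last first.
  by move=> a b /(congr1 val) /= /val_inj.
apply/subset_leq_card/subsetP => i; rewrite inE => /andP[ltij _].
by apply/imageP; exists (Ordinal ltij) => //; apply/val_inj.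
Qed.

Lemma codeE pi j : code pi j = #|smaller_before pi j| :> nat.
Proof.
rewrite ffunE inordK //; have := card_smaller_before pi j.
by have := ltn_ord j; lia.
Qed.

Lemma code_subexcedant pi : code pi \in family subexcedant.
Proof. by apply/familyP => j; rewrite inE codeE card_smaller_before. Qed.

(** The entries after position [j] determine the set of the entries up to
    position [j], in which [pi j] has rank [code pi j]. *)
Lemma code_inj : injective code.
Proof.
move=> pi rho eqc; apply/permP => j.
(* Induction on [n - j], that is, from the last position backwards, so that all values to the right
   of [j] already agree. *)
have [k lek] := ubnP (n - j); elim: k => // k IHk in j lek *.
have IH i : j < i -> pi i = rho i by move=> ltji; apply: IHk; have := ltn_ord i; lia.
pose A (sg : 'S_n) := [set sg i | i : 'I_n & i <= j].
have eqA : A pi = A rho.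
  have AE (sg : 'S_n) : A sg = ~: [set sg i | i : 'I_n & j < i].
    apply/setP => v; rewrite -[v](permKV sg) inE !mem_imset; try exact: perm_inj.
    by rewrite !inE -leqNgt.
  rewrite !AE; congr (~: _); apply: eq_in_imset => i.
  by rewrite inE => /IH.
have cardE (sg : 'S_n) : #|smaller_before sg j| = #|[set v in A sg | v < sg j]|.
  rewrite -(card_imset _ (@perm_inj _ sg)); congr #|pred_of_set _|.
  apply/setP => v; rewrite -[v](permKV sg) !inE !mem_imset; try exact: perm_inj.
  rewrite !inE; case: (ltngtP (sg^-1%g v) j) => //= /val_inj ->.
  by rewrite ltnn.
(* The rank within a fixed set is strictly monotone, so equal ranks in the common set [A pi] will
   force [pi j = rho j]. *)
have mono (B : {set 'I_n}) (v w : 'I_n) : v \in B -> v < w ->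
    #|[set u in B | u < v]| < #|[set u in B | u < w]|.
  move=> Bv ltvw; apply/proper_card/properP; split; last first.
    by exists v; rewrite !inE ?Bv ?ltnn.
  by apply/subsetP => u; rewrite !inE => /andP[-> /ltn_trans->].
have Aj (sg : 'S_n) : sg j \in A sg by apply/imset_f; rewrite inE.
have : code pi j = code rho j :> nat by rewrite eqc.
rewrite !codeE !cardE -eqA => eqr; apply/val_inj => /=.
have Ajr := Aj rho; rewrite -eqA in Ajr.
case: (ltngtP (pi j) (rho j)) => // /mono.
- by move=> /(_ _ (Aj pi)); rewrite eqr ltnn.
- by move=> /(_ _ Ajr); rewrite eqr ltnn.
Qed.

(** Position [j], counted from 0, independently takes one of the [j.+1] values up to [j]. *)
Lemma card_subexcedant : #|family subexcedant| = n`!.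
Proof.
rewrite card_family foldrE big_map big_enum /=.
rewrite fact_prod big_add1 /= big_mkord; apply: eq_bigr => j _.
have lejn : j.+1 <= n.+2 by have := ltn_ord j; lia.
rewrite -[RHS]card_ord -(card_image (f := widen_ord lejn)); last first.
  by move=> a b /(congr1 val) /= /val_inj.
apply: eq_card => k; rewrite inE; apply/idP/imageP => [lekj|[i _ ->]].
  by exists (Ordinal (lekj : k < j.+1)) => //; apply/val_inj.
by have := ltn_ord i.
Qed.

(** Surjectivity comes from counting: [code] is injective and both sets have n! elements, so no
    inverse is built. *)
Lemma imset_code : [set code pi | pi : 'S_n] = [set c in family subexcedant].
Proof.
apply/eqP; rewrite eqEcard; apply/andP; split.
  by apply/subsetP => _ /imsetP[pi _ ->]; rewrite inE code_subexcedant.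
by rewrite (card_imset _ code_inj) cardsE card_subexcedant card_Sn.
Qed.

Lemma card_code_pred (P : pred {ffun 'I_n -> 'I_n.+2}) :
  #|[set pi | P (code pi)]| = #|[set c in family subexcedant | P c]|.
Proof.
rewrite -(card_imset _ code_inj); congr #|pred_of_set _|.
apply/setP => c; rewrite inE; apply/imsetP/andP => [[pi]|[fc Pc]].
  by rewrite inE => Ppi ->; rewrite code_subexcedant.
have : c \in [set code pi | pi : 'S_n] by rewrite imset_code inE.
by case/imsetP => pi _ cE; exists pi; rewrite // inE -cE.
Qed.

Definition ord_one : 'I_n.+2 := lift ord0 ord0.

(** Position 0 is exempt because its code must be 0; every later position admits both 0 and 1. *)
Definition swap01 (c : {ffun 'I_n -> 'I_n.+2}) : {ffun 'I_n -> 'I_n.+2} :=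
  [ffun j : 'I_n => if 0 < j then tperm ord0 ord_one (c j) else c j].

Lemma swap01K : involutive swap01.
Proof. by move=> c; apply/ffunP => j; rewrite !ffunE; case: (0 < j); rewrite ?tpermK. Qed.

Lemma swap01_subexcedant c :
  c \in family subexcedant -> swap01 c \in family subexcedant.
Proof.
move=> /familyP fc; apply/familyP => j; have := fc j.
by rewrite !inE ffunE; case: ifP => // j0; case: tpermP => // ->.
Qed.

Lemma card_positions_swap01 c :
  #|[set j : 'I_n | (0 < j) && (swap01 c j == 0 :> nat)]| =
  #|[set j : 'I_n | (0 < j) && (c j == 1 :> nat)]|.
Proof.
congr #|pred_of_set _|; apply/setP => j; rewrite !inE ffunE.
case: ifP => //= _; case: tpermP => [->|->|] //.
move=> /eqP; rewrite -val_eqE /= => /negPf-> /eqP.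
by rewrite -val_eqE /= => /negPf->.
Qed.

Lemma equidistributed_code l :
  #|[set pi | #|[set j : 'I_n | (0 < j) && (code pi j == 1 :> nat)]| == l]| =
  #|[set pi | #|[set j : 'I_n | (0 < j) && (code pi j == 0 :> nat)]| == l]|.
Proof.
rewrite (card_code_pred (fun c => #|[set j : 'I_n | (0 < j) && (c j == 1 :> nat)]| == l)).
rewrite (card_code_pred (fun c => #|[set j : 'I_n | (0 < j) && (c j == 0 :> nat)]| == l)).
rewrite -(card_imset _ (inv_inj swap01K)); congr #|pred_of_set _|.
apply/setP => c; rewrite -[c]swap01K mem_imset; last exact: inv_inj swap01K.
rewrite !inE card_positions_swap01; congr (_ && _).
apply/idP/idP => /swap01_subexcedant //.
by rewrite swap01K.
Qed.

End Code.

(** * Occurrences of the two patterns read off from the code *)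

Section Occurrences.

Variables (n : nat) (pi : 'S_n).
Implicit Types (f g : {ffun 'I_2 -> 'I_n}) (i j m : 'I_n).

Local Notation i0 := (ord0 : 'I_2).
Local Notation i1 := (ord_max : 'I_2).

Lemma enum_ord2 : enum 'I_2 = [:: i0; i1].
Proof. by rewrite enum_ordSl enum_ordSl enum_ord0 /=; congr [:: _; _]; apply/val_inj. Qed.

Lemma ord2P (P : 'I_2 -> Prop) : P i0 -> P i1 -> forall a, P a.
Proof.
move=> P0 P1 [[|[|a]] lta] //.
  by rewrite (_ : Ordinal lta = i0) //; apply/val_inj.
by rewrite (_ : Ordinal lta = i1) //; apply/val_inj.
Qed.

Lemma increasing2E f : increasing f = (f i0 < f i1).
Proof.
apply/idP/idP => [/forallP/(_ i0)/forallP/(_ i1)//|lt01].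
by apply/forallP; elim/ord2P; apply/forallP; elim/ord2P.
Qed.

Lemma order_isomorphic12E f : order_isomorphic pi f perm12 = (pi (f i0) < pi (f i1)).
Proof.
apply/idP/idP => [/forallP/(_ i0)/forallP/(_ i1)|lt01].
  by rewrite !perm1 => /eqP->.
apply/forallP; elim/ord2P; apply/forallP; elim/ord2P; rewrite !perm1 ?ltnn //.
- by rewrite lt01.
- by rewrite ltnNge ltnW.
Qed.

Lemma order_isomorphic21E f : order_isomorphic pi f perm21 = (pi (f i1) < pi (f i0)).
Proof.
apply/idP/idP => [/forallP/(_ i1)/forallP/(_ i0)|lt10].
  by rewrite tpermL tpermR => /eqP->.
apply/forallP; elim/ord2P; apply/forallP; elim/ord2P;
  rewrite ?tpermL ?tpermR ?ltnn //.
- by rewrite ltnNge ltnW.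
- by rewrite lt10.
Qed.

Lemma occ_index2E f :
  (occ_index f 0 = 0) * (occ_index f 1 = (f i0).+1) * (occ_index f 2 = (f i1).+1).
Proof. by rewrite /occ_index enum_ord2. Qed.

Lemma occ_value2E f :
  (occ_value pi f 0 = 0) *
  (occ_value pi f 1 = (minn (pi (f i0)) (pi (f i1))).+1) *
  (occ_value pi f 2 = (maxn (pi (f i0)) (pi (f i1))).+1).
Proof.
rewrite /occ_value enum_ord2 /sort /= /merge /=.
by rewrite ltnS; case: leqP.
Qed.

(** The four shaded boxes fill the lower left quadrant of the corner at position
    [f i1] and height the larger value; the points on their common boundaries
    can only be those of the occurrence. *)
Lemma shading_R_emptyE f : f i0 < f i1 ->
  [forall c in shading_R, box_empty pi f c.1 c.2] =
  [forall m : 'I_n, (m < f i1) && (pi m < maxn (pi (f i0)) (pi (f i1))) ==> (m == f i0)].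
Proof.
have lt3 (e : bool) : e < 3 by case: e.
move=> lt01; apply/forall_inP/forallP => [empty m|only c].
  apply/implyP => /andP[ltm ltpm]; apply/contraT => nem.
  (* The column [a] and the row [b] of the shaded box that contains [m]. Since [m] differs from both
     points of the occurrence, it lies on no line between boxes. *)
  pose a : bool := f i0 < m.
  pose b : bool := minn (pi (f i0)) (pi (f i1)) < pi m.
  have inR : ((inord a : 'I_3), (inord b : 'I_3)) \in shading_R.
    by rewrite !inE; case: a; case: b; rewrite !eqxx ?orbT.
  have := empty _ inR; rewrite /box_empty /= !inordK //.
  move/negP; case; apply/existsP; exists m.
  have nepm0 : (pi m != pi (f i0) :> nat) by rewrite (inj_eq val_inj) (inj_eq perm_inj).
  have nepm1 : (pi m != pi (f i1) :> nat).
    by rewrite (inj_eq val_inj) (inj_eq perm_inj) -val_eqE /= neq_ltn ltm.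
  have nem' : m != f i0 :> nat by [].
  by rewrite /a /b; case: (ltnP (f i0) m) => ?; case: (ltnP (minn _ _) (pi m)) => ? /=;
    rewrite !occ_index2E !occ_value2E; lia.
move=> inR; apply/negP => /existsP[m].
have [a [b ->]] : exists a b : bool, c = (inord a, inord b).
  move: inR; rewrite !inE -!orbA => /or4P[] /eqP ->;
  by [exists false, false | exists false, true | exists true, false | exists true, true].
rewrite /= !inordK //.
have /implyP := only m.
(* A point inside any of the four boxes lies in the quadrant, hence is [f i0]; but that position
   bounds the columns and is interior to none. *)
by case: a; case: b; rewrite /= !occ_index2E !occ_value2E => only_m bnd;
  (have /only_m/eqP mE : (m < f i1) && (pi m < maxn (pi (f i0)) (pi (f i1))) by lia);
  subst m; lia.
Qed.

Lemma occurrence12P f :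
  reflect [/\ f i0 < f i1, pi (f i0) < pi (f i1) &
              forall m, m < f i1 -> pi m < pi (f i1) -> m = f i0]
    (is_occurrence pi (p := MeshPattern perm12 shading_R) f).
Proof.
rewrite /is_occurrence /= increasing2E order_isomorphic12E.
apply: (iffP and3P) => -[lt01 ltp01 H]; split=> //.
  move: H; rewrite shading_R_emptyE // (maxn_idPr (ltnW ltp01)) => /forallP H m ltm ltpm.
  by apply/eqP/(implyP (H m)); rewrite ltm.
rewrite shading_R_emptyE // (maxn_idPr (ltnW ltp01)).
by apply/forallP => m; apply/implyP => /andP[ltm ltpm]; apply/eqP/H.
Qed.

(** Here the larger value sits at [f i0], which therefore satisfies the weak inequality itself: it
    is the minimum of the entries before [f i1]. *)
Lemma occurrence21P f :
  reflect [/\ f i0 < f i1, pi (f i1) < pi (f i0) &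
              forall m, m < f i1 -> pi (f i0) <= pi m]
    (is_occurrence pi (p := MeshPattern perm21 shading_R) f).
Proof.
rewrite /is_occurrence /= increasing2E order_isomorphic21E.
apply: (iffP and3P) => -[lt01 ltp01 H]; split=> //.
  move: H; rewrite shading_R_emptyE // (maxn_idPl (ltnW ltp01)) => /forallP H m ltm.
  rewrite leqNgt; apply/negP => ltpm.
  have /eqP mE : m == f i0 by apply: (implyP (H m)); rewrite ltm.
  by rewrite mE ltnn in ltpm.
rewrite shading_R_emptyE // (maxn_idPl (ltnW ltp01)).
by apply/forallP => m; apply/implyP => /andP[/H]; rewrite leqNgt => /negPf->.
Qed.

Definition pair_ffun i j : {ffun 'I_2 -> 'I_n} :=
  [ffun a : 'I_2 => if a == i0 then i else j].

Lemma eq_ffun2 f g : f i0 = g i0 -> f i1 = g i1 -> f = g.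
Proof. by move=> e0 e1; apply/ffunP; elim/ord2P. Qed.

(** The left point is the unique element of [smaller_before] at the right point, so projecting to
    the right point is injective. *)
Lemma num_occurrences12E :
  num_occurrences pi (MeshPattern perm12 shading_R) =
  #|[set j : 'I_n | (0 < j) && (code pi j == 1 :> nat)]|.
Proof.
rewrite /num_occurrences.
rewrite -(@card_in_imset _ _ (fun f : {ffun 'I_2 -> 'I_n} => f i1)); last first.
  move=> f g; rewrite !inE.
  move=> /occurrence12P[lt ltp _] /occurrence12P[_ _ H] e1.
  by apply: eq_ffun2 => //; apply: H; rewrite -e1.
congr #|pred_of_set _|; apply/setP => j; rewrite inE codeE.
apply/imsetP/andP => [[f]|[_ /cards1P[i iE]]].
  rewrite inE => /occurrence12P[lt ltp H] ->; split; first exact: leq_ltn_trans lt.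
  apply/cards1P; exists (f i0); apply/setP => m; rewrite !inE.
  by apply/andP/eqP => [[]|->]; first exact: H.
have : i \in smaller_before pi j by rewrite iE inE.
rewrite inE => /andP[ltij ltpij]; exists (pair_ffun i j); last by rewrite ffunE.
rewrite inE; apply/occurrence12P; rewrite !ffunE /=; split=> // m ltm ltpm.
by apply/set1P; rewrite -iE inE ltm.
Qed.

Lemma num_occurrences21E :
  num_occurrences pi (MeshPattern perm21 shading_R) =
  #|[set j : 'I_n | (0 < j) && (code pi j == 0 :> nat)]|.
Proof.
rewrite /num_occurrences.
rewrite -(@card_in_imset _ _ (fun f : {ffun 'I_2 -> 'I_n} => f i1)); last first.
  move=> f g; rewrite !inE.
  move=> /occurrence21P[ltf _ Hf] /occurrence21P[ltg _ Hg] e1.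
  (* Both left points carry the minimum of the entries before the common right point. *)
  apply: eq_ffun2 => //; apply/(@perm_inj _ pi)/val_inj/eqP.
  by rewrite eqn_leq Hf ?e1 // Hg // -e1.
congr #|pred_of_set _|; apply/setP => j; rewrite inE codeE.
apply/imsetP/andP => [[f]|[j0]].
  rewrite inE => /occurrence21P[lt ltp H] ->; split; first exact: leq_ltn_trans lt.
  rewrite cards_eq0; apply/eqP/setP => m; rewrite !inE.
  by apply/andP => -[/H]; lia.
rewrite cards_eq0 => /eqP sb0.
(* Position 0 precedes [j] by [j0], so the minimum over the positions before [j] exists; its
   position is the left point. *)
pose z : 'I_n := Ordinal (leq_ltn_trans (leq0n j) (ltn_ord j)).
case: (@arg_minnP _ z (fun i : 'I_n => i < j) (fun i => pi i)) => // i ltij imin.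
exists (pair_ffun i j); last by rewrite ffunE.
rewrite inE; apply/occurrence21P; rewrite !ffunE /=; split=> //.
have /setP/(_ i) := sb0; rewrite !inE ltij /= => /negbT; rewrite -leqNgt leq_eqVlt.
case/predU1P => // /val_inj/perm_inj eji.
by rewrite eji ltnn in ltij.
Qed.

End Occurrences.

Theorem theorem2p4 :
  equidistributed (MeshPattern perm12 shading_R) (MeshPattern perm21 shading_R).
Proof.
move=> n l.
transitivity #|[set pi : 'S_n | #|[set j : 'I_n | (0 < j) && (code pi j == 1 :> nat)]| == l]|.
  by apply: eq_card => pi; rewrite !inE num_occurrences12E.
rewrite equidistributed_code.
by apply: eq_card => pi; rewrite !inE num_occurrences21E.
Qed.
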